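(* Let $\alpha>0$, $\beta>0$, $t\ge0$, and let $w(x)=e^{-t/x}x^\alpha(1-x)^\beta$ on $[0,1]$. For every integer $n\ge1$, with $r_n$, $\beta_n$, $\mathsf p_1(n)$ as defined in the context, $$r_n=\frac{-[\mathsf p_1(n)]^2-(2n+\alpha-t)\,\mathsf p_1(n)+nt-[1-(2n+\alpha+\beta)^2]\,\beta_n}{2n+\alpha+\beta}$$ with $$\beta_n=\frac{X_n}{Y_n},$$ where $$X_n:=\frac{1}{2n+\alpha+\beta}\Big[-2[\mathsf p_1(n)]^3+(3t-\alpha+2\beta-2n)[\mathsf p_1(n)]^2-\big(t^2-2(n-\beta)t-(2n+\alpha)\beta\big)\mathsf p_1(n)-(t+\beta)nt\Big]$$ and $$\begin{aligned}Y_n:=\ &(2n-1+\alpha+\beta)(2n+1+\alpha+\beta)+\frac{2}{2n+\alpha+\beta}\,\mathsf p_1(n)\\&+(2n-1+\alpha+\beta)(2n+2+\alpha+\beta)\,\mathsf p_1(n+1)-(2n+1+\alpha+\beta)(2n-2+\alpha+\beta)\,\mathsf p_1(n-1)\\&-(t+\beta)\left(\frac{1}{2n+\alpha+\beta}+2n+\alpha+\beta\right).\end{aligned}$$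
   Context: $P_n(z)=z^n+\mathsf p_1(n)z^{n-1}+\cdots$ is the monic polynomial of degree $n$ with $\int_0^1P_mP_nw\,dx=h_n\delta_{m,n}$; $\mathsf p_1(0):=0$. The recurrence coefficients $\alpha_n,\beta_n$ (not to be confused with the parameters $\alpha,\beta$) are defined by $xP_n(x)=P_{n+1}(x)+\alpha_nP_n(x)+\beta_nP_{n-1}(x)$, with $P_0=1$, $\beta_0P_{-1}=0$. $r_n:=\frac{\beta}{h_{n-1}}\int_0^1P_{n-1}(y)P_n(y)w(y)\frac{dy}{1-y}$. *)

(* Defs.v *)
From mathcomp Require Import all_boot all_order all_algebra.
From mathcomp Require Import all_classical all_reals all_analysis.

Set Implicit Arguments.
Unset Strict Implicit.
Unset Printing Implicit Defensive.

Import Order.TTheory GRing.Theory Num.Theory.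

Local Open Scope classical_set_scope.
Local Open Scope ring_scope.

(* Both endpoint values are 0 when alpha, beta > 0, since 0 `^ a = 0 for a != 0,
   so the convention t / 0 = 0 has no effect. *)
Definition pj_weight (R : realType) (alpha beta t x : R) : R :=
  expR (- t / x) * x `^ alpha * (1 - x) `^ beta.

Definition int01 (R : realType) (f : R -> R) : R :=
  \int[@lebesgue_measure R]_(x in `[0%R, 1%R]) f x.

(* The orthogonality relation at m = n determines h. *)
Definition monic_orthogonal (R : realType) (w : R -> R)
    (P : nat -> {poly R}) (h : nat -> R) : Prop :=
  (forall n : nat, P n \is monic /\ size (P n) = n.+1) /\
  (forall m n : nat,
     int01 (fun x => (P m).[x] * (P n).[x] * w x) = if m == n then h n else 0).

(* The term b_n P_{n-1} is absent for n = 0; b 0 is left unconstrained. *)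
Definition three_term_recurrence (R : realType) (P : nat -> {poly R})
    (a b : nat -> R) : Prop :=
  forall n : nat,
    'X * P n = P n.+1 + a n *: P n + (if n is k.+1 then b n *: P k else 0).

(* The coefficient of x^(n-1) in P_n, and 0 for n = 0. *)
Definition p1 (R : realType) (P : nat -> {poly R}) (n : nat) : R :=
  if n is k.+1 then (P n)`_k else 0.

(* Only meant for n >= 1. *)
Definition r_coef (R : realType) (alpha beta t : R) (P : nat -> {poly R})
    (h : nat -> R) (n : nat) : R :=
  beta / h n.-1 *
  int01 (fun y => (P n.-1).[y] * (P n).[y] * pj_weight alpha beta t y / (1 - y)).

Definition X_coef (R : realType) (alpha beta t : R) (P : nat -> {poly R})
    (n : nat) : R :=
  let N : R := n%:R in
  let p := p1 P n in
  1 / (2 * N + alpha + beta) *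
  (- 2 * p ^+ 3
   + (3 * t - alpha + 2 * beta - 2 * N) * p ^+ 2
   - (t ^+ 2 - 2 * (N - beta) * t - (2 * N + alpha) * beta) * p
   - (t + beta) * N * t).

Definition Y_coef (R : realType) (alpha beta t : R) (P : nat -> {poly R})
    (n : nat) : R :=
  let N : R := n%:R in
  (2 * N - 1 + alpha + beta) * (2 * N + 1 + alpha + beta)
  + 2 / (2 * N + alpha + beta) * p1 P n
  + (2 * N - 1 + alpha + beta) * (2 * N + 2 + alpha + beta) * p1 P n.+1
  - (2 * N + 1 + alpha + beta) * (2 * N - 2 + alpha + beta) * p1 P n.-1
  - (t + beta) * (1 / (2 * N + alpha + beta) + 2 * N + alpha + beta).

(* Main.v *)
Require Import Defs.
From HB Require Import structures.
From mathcomp Require Import all_boot all_order all_algebra.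
From mathcomp Require Import all_classical all_reals all_analysis.
From mathcomp Require Import measurable_realfun.
From mathcomp Require Import ring lra zify.

Set Implicit Arguments.
Unset Strict Implicit.
Unset Printing Implicit Defensive.

Import Order.TTheory GRing.Theory Num.Theory.
Import numFieldNormedType.Exports.

Local Open Scope classical_set_scope.
Local Open Scope ring_scope.

(* Let [L f], [J0 f] and [J1 f] be the integrals over [0, 1] of [f w], of [(t / x) f w] and of
   [(beta / (1 - x)) f w]. Integrating the derivative of [x f w] gives
     [J0 f + alpha L f + L ((x f)') = J1 f - beta L f]                           (parts).
   Put [N = 2n + alpha + beta], [s = t + beta - 2 p1(n)], [R_n = J1 (P_n ^ 2) / h_n],
   [R*_n = J0 (P_n ^ 2) / h_n], [r_n = J1 (P_(n-1) P_n) / h_(n-1)] and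
   [r*_n = J0 (P_(n-1) P_n) / h_(n-1)]. Applied to [P_n ^ 2], [x P_n ^ 2] and [P_(n-1) P_n], (parts)
   yields [R_n = R*_n + N + 1], [R_n = (N + 2) alpha_n + s] and [r*_n = r_n + p1(n)].
   Splitting off the value of [P_n] at [1], and its first Taylor coefficients at [0], and using
   orthogonality gives three quadratic relations,
     [r_n (r_n + beta) = beta_n R_n R_(n-1)],  [r*_n (r*_n - t) = beta_n R*_n R*_(n-1)],
     [(2 r*_n - t) (r_n - n) - alpha r*_n = beta_n (R*_n R_(n-1) + R_n R*_(n-1))],
   from which the formula for [r_n] and [beta_n Y_n = X_n] follow by elimination.
   To divide by [Y_n] one needs [Y_n <> 0]; in fact
     [Y_n / (N ^ 2 - 1) = 1 + s / N - R_n / (N + 1) - R_(n-1) / (N - 1) < 0].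
   If [s < N] this follows from [R*_n >= 0] and [R*_(n-1) >= 0]; if [s >= N], from
   [R_n >= s] and [R_(n-1) >= s], which express that [alpha_n] and [alpha_(n-1)] are positive. *)

(** * Orthogonal polynomials and the three functionals *)

Lemma size_subr_lead (R : nzRingType) (p q : {poly R}) k :
  (size p <= k.+1)%N -> (size q <= k.+1)%N -> p`_k = q`_k ->
  (size (p - q)%R <= k)%N.
Proof.
move=> /leq_sizeP sp /leq_sizeP sq pq; apply/leq_sizeP => j.
rewrite leq_eqVlt coefB => /predU1P[<-|kj]; first by rewrite pq subrr.
by rewrite sp// sq// subrr.
Qed.

(** First-order Taylor splitting at [a]: division by a monic linear factor lowers the degree by one
    and keeps the leading coefficient. *)
Lemma poly_div_XsubC (F : fieldType) (p : {poly F}) (a : F) :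
  exists g : {poly F}, [/\ p = p.[a]%:P + ('X - a%:P) * g,
    size g = (size p).-1 & forall n, size p = n.+2 -> g`_n = p`_n.+1].
Proof.
pose g := p %/ ('X - a%:P).
have pE : p = p.[a]%:P + ('X - a%:P) * g.
  have e := divp_eq p ('X - a%:P).
  rewrite {1}e addrC modp_XsubC mulrC //.
have sg : size g = (size p).-1.
  by rewrite size_divp ?polyXsubC_eq0// size_XsubC subn1.
exists g; split => // n sp.
rewrite [in RHS]pE coefD mulrBl coefB coefXM coefCM coefC /= add0r.
by rewrite [g`_n.+1]nth_default ?mulr0 ?subr0// sg sp.
Qed.

Section OrthogonalFunctional.
Variables (R : fieldType) (L : {scalar {poly R}}).
Variables (P : nat -> {poly R}) (h : nat -> R).
Hypothesis P_monic : forall n, P n \is monic /\ size (P n) = n.+1.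
Hypothesis orthP : forall m n, L (P m * P n) = if m == n then h n else 0.

Lemma monic_coef n : (P n)`_n = 1.
Proof. by have [/monicP + sP] := P_monic n; rewrite lead_coefE sP. Qed.

Lemma size_monic n : size (P n) = n.+1. Proof. by have [] := P_monic n. Qed.

Lemma functionalZ c f : L (c *: f) = c * L f.
Proof. exact: linearZ. Qed.

Lemma functional_mulC c f : L (c%:P * f) = c * L f.
Proof. by rewrite mul_polyC functionalZ. Qed.

Lemma orth_lower n (g : {poly R}) : (size g <= n)%N -> L (g * P n) = 0.
Proof.
(* With [n] fixed, the induction runs on a separate size bound [k], so that the top term of [g] is
   removed by a multiple of an earlier [P k]. *)
suff low k : (k <= n)%N -> forall g : {poly R}, (size g <= k)%N -> L (g * P n) = 0.
  exact: low.
elim: k => [|k IHk] kn {}g sg.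
  by move: sg; rewrite leqn0 size_poly_eq0 => /eqP->; rewrite mul0r linear0.
have -> : g = (g - g`_k *: P k) + g`_k *: P k by rewrite subrK.
rewrite mulrDl linearD -scalerAl functionalZ orthP IHk ?(ltnW kn)//.
  by rewrite ltn_eqF// mulr0 addr0.
apply: size_subr_lead => //.
  by rewrite (leq_trans (size_scale_leq _ _))// size_monic.
by rewrite coefZ monic_coef mulr1.
Qed.

Lemma orth_lead n (g : {poly R}) : (size g <= n.+1)%N -> L (g * P n) = g`_n * h n.
Proof.
move=> sg; have -> : g = (g - g`_n *: P n) + g`_n *: P n by rewrite subrK.
rewrite mulrDl linearD orth_lower.
  by rewrite -scalerAl functionalZ orthP eqxx add0r subrK.
apply: size_subr_lead => //.
  by rewrite (leq_trans (size_scale_leq _ _))// size_monic.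
by rewrite coefZ monic_coef mulr1.
Qed.

End OrthogonalFunctional.

(** * Recurrence coefficients and Euler derivatives *)

Section PollaczekJacobiFunctionals.
Variables (R : realType) (L J0 J1 : {scalar {poly R}}).
Variables (alpha beta t : R).
Variables (P : nat -> {poly R}) (h a b : nat -> R).
Hypothesis P_monic : forall n, P n \is monic /\ size (P n) = n.+1.
Hypothesis orthP : forall m n, L (P m * P n) = if m == n then h n else 0.
Hypothesis recP : three_term_recurrence P a b.
Hypothesis h_gt0 : forall n, 0 < h n.
Hypothesis J0X : forall f : {poly R}, J0 ('X * f) = t * L f.
Hypothesis J1X : forall f : {poly R}, J1 ('X * f) = J1 f - beta * L f.
Hypothesis parts : forall f,
  J0 f + alpha * L f + L ('X * f)^`() = J1 f - beta * L f.

Let lower := orth_lower P_monic orthP.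
Let lead := orth_lead P_monic orthP.

Let Rs n := J0 (P n * P n) / h n.
Let Rn n := J1 (P n * P n) / h n.
Let rs n := J0 (P n.-1 * P n) / h n.-1.
Let r n := J1 (P n.-1 * P n) / h n.-1.

Lemma h_neq0 n : h n != 0. Proof. by rewrite gt_eqF. Qed.

Lemma functional_X_sqr n : L ('X * P n * P n) = a n * h n.
Proof.
rewrite recP !mulrDl !linearD /= orthP.
rewrite eqn_leq ltnn /= add0r -scalerAl functionalZ orthP eqxx.
case: n => [|n]; first by rewrite mul0r linear0 addr0.
by rewrite -scalerAl functionalZ orthP eqn_leq ltnn andbF mulr0 addr0.
Qed.

(** [L ('X * P n * P n.+1)] is computed twice: by the recurrence for ['X * P n.+1], and from the
    leading coefficient of ['X * P n]. *)
Lemma recurrence_b n : b n.+1 = h n.+1 / h n.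
Proof.
have e : L ('X * P n.+1 * P n) = L ('X * P n * P n.+1) by congr (L _); ring.
move: e; rewrite [RHS]lead; last first.
  by rewrite mulrC size_mulX ?size_monic// monic_neq0//; case: (P_monic n).
rewrite coefXM /= monic_coef// mul1r => <-.
rewrite recP !mulrDl !linearD /= orthP -!scalerAl !functionalZ !orthP.
have -> : (n.+2 == n) = false by lia.
have -> : (n.+1 == n) = false by lia.
by rewrite eqxx mulr0 !add0r mulfK ?h_neq0.
Qed.

Lemma p1_recurrence n : p1 P n = p1 P n.+1 + a n.
Proof.
have /(congr1 (fun f : {poly R} => f`_n)) := recP n.
rewrite !coefD coefXM coefZ monic_coef// mulr1 /=.
case: n => [|n] /=; first by rewrite coef0 addr0.
by rewrite coefZ [(P n)`_n.+1]nth_default ?size_monic// mulr0 addr0.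
Qed.

Lemma size_X_mul_leq (n : nat) (f : {poly R}) :
  (size f <= n)%N -> (size ('X * f)%R <= n.+1)%N.
Proof.
move=> sf; have [->|f0] := eqVneq f 0; first by rewrite mulr0 size_poly0.
by rewrite mulrC size_mulX.
Qed.

Lemma size_derivP n : (size (P n)^`() <= n)%N.
Proof.
rewrite -ltnS -(size_monic P_monic n) lt_size_deriv// monic_neq0//.
by case: (P_monic n).
Qed.

(** The Euler operator [x d/dx] multiplies [x ^ k] by [k], so the top term cancels, and the next
    coefficient is [n - n.+1] times [p1 P n.+1]. *)
Lemma size_XderivP n :
  (size ('X * (P n.+1)^`() - n.+1%:R%:P * P n.+1)%R <= n.+1)%N.
Proof.
apply: size_subr_lead.
- exact/size_X_mul_leq/size_derivP.
- by rewrite mul_polyC (leq_trans (size_scale_leq _ _))// size_monic.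
- by rewrite coefXM coefCM coef_deriv/= monic_coef// mulr1.
Qed.

Lemma coef_XderivP n :
  ('X * (P n.+1)^`() - n.+1%:R%:P * P n.+1)`_n = - p1 P n.+1.
Proof.
rewrite coefB coefXM coefCM /=; case: n => [|n] /=.
  by rewrite mul1r sub0r.
by rewrite coef_deriv -[n.+2]addn1 natrD; ring.
Qed.

Lemma functional_deriv_mul n : L ((P n)^`() * P n) = 0.
Proof. exact/lower/size_derivP. Qed.

(** * Linear identities from integration by parts *)

Lemma Rn_Rs n : Rn n = Rs n + (2 * n%:R + 1 + alpha + beta).
Proof.
have := parts (P n * P n); rewrite !orthP eqxx.
have -> : L ('X * (P n * P n))^`() = (2 * n%:R + 1) * h n.
  have -> : ('X * (P n * P n))^`() = P n * P n
     + ('X * (P n)^`()) * P n + ('X * (P n)^`()) * P n.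
    by rewrite !derivM derivX; ring.
  rewrite !linearD /= orthP eqxx lead; last exact/size_X_mul_leq/size_derivP.
  rewrite coefXM; case: n => [|n] /=; first by ring.
  by rewrite coef_deriv monic_coef//; ring.
move=> e; rewrite /Rn /Rs.
have -> : J1 (P n * P n) = J0 (P n * P n) + (2 * n%:R + 1 + alpha + beta) * h n.
  by lra.
by rewrite mulrDl mulfK ?h_neq0.
Qed.

Lemma Rn_recurrence_coef n :
  Rn n = (2 * n%:R + 2 + alpha + beta) * a n - 2 * p1 P n + t + beta.
Proof.
have := parts ('X * (P n * P n)); rewrite J0X J1X !orthP eqxx.
rewrite mulrA functional_X_sqr.
have -> : L ('X * ('X * P n * P n))^`()
   = (2 * n%:R + 2) * (a n * h n) - 2 * p1 P n * h n.
  have -> : ('X * ('X * P n * P n))^`() = 'X * P n * P n + 'X * P n * P n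
     + ('X * ('X * (P n)^`()) * P n + 'X * ('X * (P n)^`()) * P n).
    by rewrite !derivM derivX; ring.
  rewrite !linearD /= !functional_X_sqr.
  (* With [x P' = n P + g], the first term gives [n a h], and the second pairs with [P] through the
     leading coefficient [- p1] of [x g]. For [n = 0] both sides vanish. *)
  have -> : L ('X * ('X * (P n)^`()) * P n) = n%:R * (a n * h n) - p1 P n * h n.
    case: n => [|n].
      have -> : (P 0)^`() = 0.
        by apply/eqP; rewrite -size_poly_eq0 -leqn0; exact: size_derivP.
      by rewrite !mulr0 mul0r linear0 /=; ring.
    set g := 'X * (P n.+1)^`() - n.+1%:R%:P * P n.+1.
    have -> : 'X * ('X * (P n.+1)^`()) * P n.+1
      = n.+1%:R%:P * ('X * P n.+1 * P n.+1) + ('X * g) * P n.+1.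
      by rewrite /g; ring.
    rewrite linearD /= functional_mulC functional_X_sqr lead ?size_X_mul_leq ?size_XderivP//.
    by rewrite coefXM /= coef_XderivP mulNr.
  by ring.
move=> e; rewrite /Rn.
have -> : J1 (P n * P n) =
    ((2 * n%:R + 2 + alpha + beta) * a n - 2 * p1 P n + t + beta) * h n.
  by lra.
by rewrite mulfK ?h_neq0.
Qed.

(** In (parts) at [P n * P n.+1], orthogonality kills every [L] term except [L (g * P n)], whose
    value [- p1 P n.+1 * h n] is therefore the difference [J1 - J0]. *)
Lemma rs_r n : rs n.+1 = r n.+1 + p1 P n.+1.
Proof.
have := parts (P n * P n.+1); rewrite !orthP.
have -> : (n == n.+1) = false by lia.
set g := 'X * (P n.+1)^`() - n.+1%:R%:P * P n.+1.
have -> : ('X * (P n * P n.+1))^`() = P n * P n.+1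
     + ('X * (P n)^`()) * P n.+1 + (n.+1%:R%:P * (P n * P n.+1) + g * P n).
  by rewrite !derivM derivX /g; ring.
rewrite !linearD /= functional_mulC orthP lower; last exact/size_X_mul_leq/size_derivP.
rewrite lead ?size_XderivP// coef_XderivP.
have -> : (n == n.+1) = false by lia.
rewrite !mulr0 !addr0 subr0 !add0r => e.
rewrite /rs /r /= -e mulrDl mulNr mulNr mulfK ?h_neq0//.
by rewrite subrK.
Qed.

(** * Quadratic relations from expansions at the endpoints *)

Lemma J1_split n (f : {poly R}) : exists2 g : {poly R},
  size g = n /\ ((0 < n)%N -> g`_n.-1 = 1) &
  J1 (P n * f) = (P n).[1] * J1 f - beta * L (g * f).
Proof.
(* In [P n = (P n).[1] + (x - 1) g] the factor [x - 1] cancels the pole of [J1] and leaves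
   [- beta * L (g * f)]. *)
have [g [Pg sg gn]] := poly_div_XsubC (P n) 1.
exists g; first split.
- by rewrite sg size_monic.
- by case: n Pg sg gn => // n _ _ ->; rewrite ?monic_coef// size_monic.
- have -> : P n * f = (P n).[1]%:P * f + ('X * (g * f) - g * f).
    by rewrite {1}Pg; ring.
  by rewrite linearD linearB /= functional_mulC J1X; ring.
Qed.

(** The mixed integral is split at 1 in either factor. The product of the two results equals the
    product of the two diagonal integrals, each of which is a value at 1 times [J1] of one
    polynomial. *)
Lemma r_quadratic n :
  r n.+1 * (r n.+1 + beta) = b n.+1 * (Rn n.+1 * Rn n).
Proof.
rewrite recurrence_b /r /Rn /=.
have [g [sg _] e1] := J1_split n.+1 (P n.+1).
have [g' [sg' _] e2] := J1_split n (P n).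
have [f [sf _] e3] := J1_split n (P n.+1).
have [f' [sf' f'n] e4] := J1_split n.+1 (P n).
rewrite lower ?sg// mulr0 subr0 in e1.
rewrite lower ?sg'// mulr0 subr0 in e2.
rewrite lower ?sf// mulr0 subr0 in e3.
(* Only here does the [L] term survive: the quotient of [P n.+1] is monic of degree [n], which
   produces the shift by [beta]. *)
rewrite lead ?sf'// f'n// mul1r mulrC in e4.
have e5 : J1 (P n * P n.+1) / h n + beta = (P n.+1).[1] * J1 (P n) / h n.
  by rewrite e4; field; exact: h_neq0.
rewrite e5 e1 e2 e3.
by field; rewrite !h_neq0.
Qed.

(* The integral of [(t / x ^ 2 + alpha / x) f w], expressed through (parts). *)
Let J2 (f : {poly R}) := J1 f - L f^`().

Lemma J2X (f : {poly R}) : J2 ('X * f) = J0 f + alpha * L f.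
Proof. by rewrite /J2 J1X -parts addrK. Qed.

(** [J2] has a double pole at 0, so two Taylor coefficients are split off: [P n = (P n).[0] + x g]
    and [g = g.[0] + x k]. A factor [x] turns [J2] into [J0 + alpha * L] and [J0] into [t * L]. *)
Lemma J0_J2_split n : exists g : {poly R}, exists k : {poly R}, [/\
  size g = n /\ ((0 < n)%N -> g`_n.-1 = 1), size k = n.-1,
  forall f, J0 (P n * f) = (P n).[0] * J0 f + t * L (g * f) &
  forall f, J2 (P n * f) = (P n).[0] * J2 f + g.[0] * J0 f + t * L (k * f)
    + alpha * L (g * f)].
Proof.
have [g [Pg sg gn]] := poly_div_XsubC (P n) 0.
have [k [gk sk _]] := poly_div_XsubC g 0.
rewrite subr0 in Pg gk.
have PgE f : P n * f = (P n).[0]%:P * f + 'X * (g * f).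
  by rewrite {1}Pg; ring.
exists g, k; split=> [||f|f].
- rewrite sg size_monic//; split => //.
  by case: n Pg sg gn {PgE} => // n _ _ ->; rewrite ?monic_coef// size_monic.
- by rewrite sk sg size_monic.
- by rewrite PgE linearD /= functional_mulC J0X.
- have J2D u v : J2 (u + v) = J2 u + J2 v.
    by rewrite /J2 derivD !linearD /=; ring.
  have J2C c u : J2 (c%:P * u) = c * J2 u.
    by rewrite /J2 !mul_polyC derivZ !functionalZ; ring.
  rewrite PgE J2D J2C J2X.
  have -> : J0 (g * f) = g.[0] * J0 f + t * L (k * f).
    have -> : g * f = g.[0]%:P * f + 'X * (k * f) by rewrite {1}gk; ring.
    by rewrite linearD /= functional_mulC J0X.
  by ring.
Qed.

Lemma Rn_J2 n : Rn n = J2 (P n * P n) / h n.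
Proof.
rewrite /J2 derivM [P n * _^`()]mulrC linearD /= functional_deriv_mul.
by rewrite addr0 subr0.
Qed.

(** The derivative of [P n.+1] pairs with [P n] to give [n.+1 * h n]; this is the shift of [r] in
    the mixed relation. *)
Lemma r_J2 n : r n.+1 - n.+1%:R = J2 (P n * P n.+1) / h n.
Proof.
rewrite /J2 derivM [P n * _^`()]mulrC linearD /=.
rewrite lower; last by rewrite (leq_trans (size_derivP n)).
rewrite lead ?size_derivP// coef_deriv monic_coef// add0r.
by rewrite /r /= mulrBl mulfK ?h_neq0.
Qed.

(** The first relation repeats at 0, with [J0], the argument used at 1. The second pairs [J0] with
    [J2], both mixed integrals being split in either factor. *)
Lemma rs_quadratic n :
  rs n.+1 * (rs n.+1 - t) = b n.+1 * (Rs n.+1 * Rs n) /\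
  2 * rs n.+1 * (r n.+1 - n.+1%:R) - t * (r n.+1 - n.+1%:R) - alpha * rs n.+1
  = b n.+1 * (Rs n.+1 * Rn n + Rn n.+1 * Rs n).
Proof.
rewrite recurrence_b !Rn_J2 r_J2 /rs /Rs /=.
have [g [k [[sg gn] sk J0P J2P]]] := J0_J2_split n.+1.
have [g' [k' [[sg' _] sk' J0P' J2P']]] := J0_J2_split n.
have J0PQ : J0 (P n * P n.+1) = (P n.+1).[0] * J0 (P n) + t * h n.
  by rewrite mulrC J0P lead ?sg// gn// mul1r.
have J2PQ : J2 (P n * P n.+1) = (P n.+1).[0] * J2 (P n) + g.[0] * J0 (P n) + alpha * h n.
  rewrite mulrC J2P [L (k * _)]lower ?sk// [L (g * _)]lead ?sg// gn//.
  by rewrite mul1r mulr0 addr0.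
have rs_t : J0 (P n * P n.+1) / h n - t = (P n.+1).[0] * J0 (P n) / h n.
  by rewrite J0PQ; field; exact: h_neq0.
have J0P1 : J0 (P n.+1 * P n.+1) = (P n.+1).[0] * J0 (P n.+1).
  by rewrite J0P lower ?sg// mulr0 addr0.
have J0P0 : J0 (P n * P n) = (P n).[0] * J0 (P n).
  by rewrite J0P' lower ?sg'// mulr0 addr0.
have J0P01 : J0 (P n * P n.+1) = (P n).[0] * J0 (P n.+1).
  by rewrite J0P' lower ?sg'// mulr0 addr0.
have J2P1 : J2 (P n.+1 * P n.+1) = (P n.+1).[0] * J2 (P n.+1) + g.[0] * J0 (P n.+1).
  by rewrite J2P !lower ?sg ?sk// !mulr0 !addr0.
have J2P0 : J2 (P n * P n) = (P n).[0] * J2 (P n) + g'.[0] * J0 (P n).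
  by rewrite J2P' !lower ?sg' ?sk' ?leq_pred// !mulr0 !addr0.
have J2P01 : J2 (P n * P n.+1) = (P n).[0] * J2 (P n.+1) + g'.[0] * J0 (P n.+1).
  by rewrite J2P' !lower ?sg' ?sk' ?(leq_trans (leq_pred _))// !mulr0 !addr0.
set j := J2 (P n * P n.+1) / h n; set s := J0 (P n * P n.+1) / h n.
split.
  by rewrite rs_t /s J0P01 J0P1 J0P0; field; rewrite !h_neq0.
(* Each summand combines opposite splittings of the two mixed integrals; the terms in [g.[0]] and
   [g'.[0]] match the right side only after adding. *)
have -> : 2 * s * j - t * j - alpha * s = s * (j - alpha) + (s - t) * j by ring.
have -> : s * (j - alpha) =
  (P n).[0] * J0 (P n.+1) / h n * (((P n.+1).[0] * J2 (P n) + g.[0] * J0 (P n)) / h n).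
  by rewrite /s /j J0P01 J2PQ; field; exact: h_neq0.
rewrite rs_t /j J2P01 J0P1 J0P0 J2P1 J2P0.
by field; rewrite !h_neq0.
Qed.

(** The neighbouring [p1] are traded for [a n] and [a n.+1]. With [s = t + beta - 2 * p1 P n.+1] one
    has [Rn n = (N - 2) * a n + s] and [Rn n.+1 = (N + 2) * a n.+1 + s]. *)
Lemma Y_coefE n (N := 2 * n.+1%:R + alpha + beta) : N - 1 != 0 -> N != 0 -> N + 1 != 0 ->
  Y_coef alpha beta t P n.+1 = (N ^+ 2 - 1) * (1 + (t + beta - 2 * p1 P n.+1) / N
   - Rn n.+1 / (N + 1) - Rn n / (N - 1)).
Proof.
move=> N1 N0 N2.
have e1 : p1 P n.+2 = p1 P n.+1 - a n.+1 by rewrite [p1 P n.+1]p1_recurrence addrK.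
have e2 : p1 P n = p1 P n.+1 + a n by rewrite p1_recurrence.
rewrite /Y_coef !Rn_recurrence_coef -/N e1 -pred_Sn e2.
(* Eliminating [alpha] makes the claim a rational identity in a free [N]. *)
have aE : alpha = N - 2 * n.+1%:R - beta by rewrite /N; ring.
move: N1 N0 N2; rewrite aE -[n.+1%:R]natr1.
clearbody N => N1 N0 N2.
field.
by rewrite N1 N0 N2.
Qed.


(** * Sign of the denominator and elimination *)

Hypotheses (alpha_gt0 : 0 < alpha) (beta_gt0 : 0 < beta).
Hypothesis J0_ge0 : forall n, 0 <= J0 (P n * P n).
Hypothesis LX_gt0 : forall n, 0 < L ('X * P n * P n).

Lemma recurrence_a_gt0 n : 0 < a n.
Proof. by move: (LX_gt0 n); rewrite functional_X_sqr pmulr_lgt0. Qed.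

Lemma Rs_ge0 n : 0 <= Rs n.
Proof. by rewrite /Rs divr_ge0// ltW. Qed.

Lemma Y_coef_lt0 n : Y_coef alpha beta t P n.+1 < 0.
Proof.
set N : R := 2 * n.+1%:R + alpha + beta.
have n1 : 1 <= n.+1%:R :> R by rewrite ler1n.
have [al0 be0] := conj alpha_gt0 beta_gt0.
have N2 : 2 < N by rewrite /N; lra.
rewrite Y_coefE -/N; [|lra..].
rewrite pmulr_rlt0; last by rewrite subr_gt0 expr_gt1//; lra.
set s := t + beta - 2 * p1 P n.+1.
have Rn1_s : s <= Rn n.+1.
  rewrite Rn_recurrence_coef /s; have : 0 < (N + 2) * a n.+1 by rewrite mulr_gt0 ?recurrence_a_gt0//; lra.
  by rewrite /N; lra.
have Rn0_s : s <= Rn n.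
  have : 0 < (N - 2) * a n by rewrite mulr_gt0 ?recurrence_a_gt0//; lra.
  by rewrite Rn_recurrence_coef [p1 P n]p1_recurrence /s /N -[n.+1%:R]natr1; lra.
have Rn1_N : N + 1 <= Rn n.+1.
  by rewrite Rn_Rs /N; have := Rs_ge0 n.+1; lra.
have Rn0_N : N - 1 <= Rn n.
  by rewrite Rn_Rs /N -[n.+1%:R]natr1; have := Rs_ge0 n; lra.
have [sN|Ns] := ltP s N.
  have : s / N < 1 by rewrite ltr_pdivrMr ?mul1r//; lra.
  have : 1 <= Rn n.+1 / (N + 1) by rewrite ler_pdivlMr ?mul1r//; lra.
  have : 1 <= Rn n / (N - 1) by rewrite ler_pdivlMr ?mul1r//; lra.
  by lra.
have : 1 <= s / N by rewrite ler_pdivlMr ?mul1r//; lra.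
have : s / (N + 1) <= Rn n.+1 / (N + 1) by rewrite ler_pM2r ?invr_gt0//; lra.
have : s / (N - 1) <= Rn n / (N - 1) by rewrite ler_pM2r ?invr_gt0//; lra.
(* Strict convexity of the inverse at [N - 1], [N], [N + 1]; since [1 <= s / N], the left side
   bounds [1 + s / N]. *)
have : 2 * (s / N) < s / (N + 1) + s / (N - 1).
  have -> : s / (N + 1) + s / (N - 1) = 2 * (s / N) + 2 * s / (N * (N + 1) * (N - 1)).
    by field; rewrite !gt_eqF//; lra.
  by rewrite ltrDl divr_gt0// !mulr_gt0//; lra.
by lra.
Qed.

(** After substitution for [Rn] and [rs], the sum of the two quadratic relations minus the mixed one
    loses every [Rs] term and the square of [r]. What remains is linear, with [r] multiplied by [N]
    and [b] by [N ^ 2 - 1]. *)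
Lemma r_coef_b_formula n (N := 2 * n.+1%:R + alpha + beta) (p := p1 P n.+1) :
  r n.+1 = (- p ^+ 2 - (2 * n.+1%:R + alpha - t) * p + n.+1%:R * t
     - (1 - N ^+ 2) * b n.+1) / N.
Proof.
have N0 : N != 0 by rewrite gt_eqF// /N !addr_gt0// mulr_gt0.
have [q0 q1] := rs_quadratic n.
move: q0 q1 (r_quadratic n); rewrite !Rn_Rs rs_r -/p => q0 q1 q2.
apply: (mulIf N0); rewrite divfK//.
have -> : N = 2 * n%:R + 2 + alpha + beta by rewrite /N -[n.+1%:R]natr1; ring.
move: q0 q1 q2; rewrite -[n.+1%:R]natr1.
lra.
Qed.

Lemma b_X_Y n :
  b n.+1 = X_coef alpha beta t P n.+1 / Y_coef alpha beta t P n.+1.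
Proof.
have Y0 : Y_coef alpha beta t P n.+1 != 0 by rewrite lt_eqF// Y_coef_lt0.
apply: (mulIf Y0); rewrite divfK//.
set N : R := 2 * n.+1%:R + alpha + beta; set p := p1 P n.+1.
have N2 : 2 < N.
  have n1 : 1 <= n.+1%:R :> R by rewrite ler1n.
  by have [al0 be0] := conj alpha_gt0 beta_gt0; rewrite /N; lra.
have N0 : N != 0 by rewrite gt_eqF//; lra.
have rN : r n.+1 * N = - p ^+ 2 - (2 * n.+1%:R + alpha - t) * p + n.+1%:R * t
     - (1 - N ^+ 2) * b n.+1 by rewrite r_coef_b_formula divfK.
have [q0 _] := rs_quadratic n.
move: q0 (r_quadratic n); rewrite !Rn_Rs rs_r -/p => q0 q1.
have NE : 2 * n%:R + 1 + alpha + beta = N - 1 by rewrite /N -[n.+1%:R]natr1; ring.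
(* In the difference of the relations at 1 and at 0, [Rs n.+1 * Rs n] and the square of [r] cancel;
   the remaining combination of [Rs] is the one inside [Y_coef]. *)
have q : b n.+1 * ((N - 1) * Rs n.+1 + (N + 1) * Rs n + N ^+ 2 - 1)
   = r n.+1 * (t + beta - 2 * p) - p * (p - t).
  move: q0 q1; rewrite NE.
  have -> : 2 * n.+1%:R + 1 + alpha + beta = N + 1 by rewrite /N; ring.
  by lra.
apply: (mulIf N0).
have -> : b n.+1 * Y_coef alpha beta t P n.+1 * N =
   (N ^+ 2 - 1) * (N + (t + beta - 2 * p)) * b n.+1
   - N * (b n.+1 * ((N - 1) * Rs n.+1 + (N + 1) * Rs n + N ^+ 2 - 1))
   - N * b n.+1 * (N ^+ 2 - 1).
  rewrite Y_coefE -/N; [|by rewrite gt_eqF//; lra..].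
  rewrite -/p !Rn_Rs NE.
  have -> : 2 * n.+1%:R + 1 + alpha + beta = N + 1 by rewrite /N; ring.
  by field; rewrite !gt_eqF//; lra.
have NK z : 1 / N * z * N = z by field.
rewrite q /X_coef -/N -/p NK.
(* Once [r n.+1 * N] is isolated, the formula for [r] replaces it and the multiples of [b]
   cancel. *)
have -> : (N ^+ 2 - 1) * (N + (t + beta - 2 * p)) * b n.+1 -
  N * (r n.+1 * (t + beta - 2 * p) - p * (p - t)) - N * b n.+1 * (N ^+ 2 - 1)
 = (N ^+ 2 - 1) * (t + beta - 2 * p) * b n.+1 + N * p * (p - t)
   - (r n.+1 * N) * (t + beta - 2 * p) by ring.
by rewrite rN /N; ring.
Qed.

End PollaczekJacobiFunctionals.

(** * Integrals with an integrable singularity at 1 *)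

Lemma is_derive_continuous (R : realType) (F : R -> R) (x l : R) :
  is_derive x 1 F l -> {for x, continuous F}.
Proof.
by move=> [dF _]; exact/differentiable_continuous/derivable1_diffP.
Qed.

Lemma FTC2_is_derive (R : realType) (f F : R -> R) (a b : R) : a < b ->
  (forall x, a <= x <= b -> {for x, continuous f}) ->
  (forall x, a <= x <= b -> is_derive x 1 F (f x)) ->
  (\int[lebesgue_measure]_(x in `[a, b]) (f x)%:E = (F b - F a)%:E)%E.
Proof.
move=> ab cf dF; have cF x xab := is_derive_continuous (dF x xab).
rewrite EFinB; apply: continuous_FTC2 => //.
- by apply: continuous_in_subspaceT => x; rewrite inE/= in_itv/= => /cf.
- split.
  + move=> x; rewrite in_itv/= => /andP[/ltW ax /ltW xb].
    by have /dF [] : a <= x <= b by rewrite ax xb.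
  + have /cF Fa : a <= a <= b by rewrite lexx ltW.
    exact: cvg_at_right_filter.
  + have /cF Fb : a <= b <= b by rewrite lexx ltW.
    exact: cvg_at_left_filter.
- move=> x; rewrite in_itv/= => /andP[/ltW ax /ltW xb].
  by rewrite derive1E; have /dF [] : a <= x <= b by rewrite ax xb.
Qed.

(** Allows [f] to be unbounded near the endpoints. The fundamental theorem is used on compact
    subintervals, and integrability makes the integral continuous in its upper bound. *)
Lemma Rintegral_oo_is_derive (R : realType) (f F : R -> R) (a b la lb : R) :
  a < b -> lebesgue_measure.-integrable `[a, b] (EFin \o f) ->
  (forall x, a < x < b -> {for x, continuous f}) ->
  (forall x, a < x < b -> is_derive x 1 F (f x)) ->
  F x @[x --> a^'+] --> la -> F x @[x --> b^'-] --> lb ->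
  \int[lebesgue_measure]_(x in `[a, b]) f x = lb - la.
Proof.
move=> ab intf cf dF Fa Fb.
pose G x := \int[lebesgue_measure]_(y in `[a, x]) f y.
have GF x y : a < x -> x < y -> y < b -> G y - G x = F y - F x.
  move=> ax xy yb.
  rewrite /G Rintegral_itvB; last 3 first.
  - by apply: integrableS intf => //; apply: subset_itvl; rewrite bnd_simp ltW.
  - by rewrite bnd_simp ltW.
  - by rewrite bnd_simp ltW.
  have sub : `[x, y] `<=` `[a, b].
    by apply: subset_itv; rewrite bnd_simp ltW.
  rewrite Rintegral_itv_obnd_cbnd; last first.
    by apply: integrableS intf => //; apply: subset_trans sub; exact: subset_itv_oc_cc.
  have xyab z : x <= z <= y -> a < z < b.
    by move=> /andP[xz zy]; rewrite (lt_le_trans ax)//= (le_lt_trans zy).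
  have e := FTC2_is_derive xy (fun z zxy => cf z (xyab z zxy))
    (fun z zxy => dF z (xyab z zxy)).
  by rewrite /Rintegral e.
have Ga : G x @[x --> a^'+] --> 0.
  by apply: cvg_at_right_filter; exact: parameterized_integral_cvg_left intf.
have Gb : G x @[x --> b^'-] --> G b.
  exact: parameterized_integral_cvg_at_left intf.
(* The upper end tends to [b] first, with [x] fixed; then [x] tends to [a]. *)
have GbF x : a < x -> x < b -> G b - G x = lb - F x.
  move=> ax xb.
  have c1 : (fun y => G y - G x) y @[y --> b^'-] --> G b - G x.
    by apply: cvgB => //; exact: cvg_cst.
  have c2 : (fun y => G y - G x) y @[y --> b^'-] --> lb - F x.
    apply: cvg_trans (cvgB Fb (cvg_cst (F x))).
    apply: near_eq_cvg; near=> y.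
    by rewrite /= GF.
  exact: cvg_unique c1 c2.
have c1 : (fun x => G b - G x) x @[x --> a^'+] --> G b - 0.
  by apply: cvgB => //; exact: cvg_cst.
have c2 : (fun x => G b - G x) x @[x --> a^'+] --> lb - la.
  apply: cvg_trans (cvgB (cvg_cst lb) Fa).
  apply: near_eq_cvg; near=> x.
  by rewrite /= GbF.
by rewrite -[LHS]subr0; exact: cvg_unique c1 c2.
Unshelve. all: by end_near. Qed.

Lemma is_derive_powR_onem (R : realType) (b x : R) : x < 1 ->
  is_derive x 1 (fun y : R => (1 - y) `^ b) (- (b * (1 - x) `^ (b - 1))).
Proof.
move=> x1; have x0 : 0 < 1 - x by rewrite subr_gt0.
have d1 := is_derive1_powR b x0.
have d2 : is_derive x 1 (fun y : R => 1 - y) (-1).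
  by apply: trigger_derive; rewrite add0r mul1r.
apply: is_derive_eq (@is_derive1_comp _ _ (fun y : R => 1 - y) _ _ _ d1 d2) _.
exact: mulrN1.
Qed.

(** The antiderivative [- (1 - x) ^ b / b] bounds the integrals over an exhaustion of [[0, 1[] by
    [1 / b], and monotone convergence passes to the limit. *)
Lemma integrable_powR_itv (R : realType) (b : R) : 0 < b ->
  lebesgue_measure.-integrable `[0, 1] (EFin \o (fun x : R => (1 - x) `^ (b - 1))).
Proof.
move=> b0.
have m A : measurable_fun A (fun x : R => (1 - x) `^ (b - 1)).
  apply: measurable_funTS; apply: (measurableT_comp (@measurable_powR R (b - 1))).
  exact: measurable_funB.
have mE A : measurable_fun A (EFin \o (fun x : R => (1 - x) `^ (b - 1))).
  by apply/measurable_EFinP; exact: m.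
(* The offset 2 keeps the right end positive already for [i = 0]. *)
pose F (i : nat) := `[0, 1 - i.+2%:R^-1 : R]%classic.
have bndF i : (\int[lebesgue_measure]_(x in F i) ((1 - x) `^ (b - 1))%:E <= (1 / b)%:E)%E.
  have lt1 : 0 < i.+2%:R^-1 :> R by rewrite invr_gt0.
  have e : (\int[lebesgue_measure]_(x in F i) ((1 - x) `^ (b - 1))%:E =
      ((- b^-1) * (1 - (1 - i.+2%:R^-1)) `^ b - (- b^-1) * (1 - 0) `^ b)%:E)%E.
    apply: (@FTC2_is_derive _ _ (fun x => (- b^-1) * (1 - x) `^ b)).
    - by rewrite subr_gt0 invf_lt1// ltr1n.
    - move=> x /andP[x0 x1].
      have x_lt1 : x < 1 by rewrite (le_lt_trans x1)// gtrBl.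
      exact: is_derive_continuous (is_derive_powR_onem _ x_lt1).
    - move=> x /andP[x0 x1].
      have x_lt1 : x < 1 by rewrite (le_lt_trans x1)// gtrBl.
      apply: is_derive_eq (is_deriveZ (- b^-1) (is_derive_powR_onem b x_lt1)) _.
      by rewrite /GRing.scale/=; field; rewrite gt_eqF.
  rewrite e lee_fin subr0 powR1 !mulNr opprK addrC mulr1 div1r gerDl.
  by rewrite oppr_le0 mulr_ge0 ?powR_ge0 ?invr_ge0 ?ltW.
apply/integrableP; split; first exact: mE.
under eq_integral do rewrite /= ger0_norm ?powR_ge0//.
rewrite -integral_itv_bndo_bndc; last exact: mE.
have -> : `[0%R, 1%R[%classic = \bigcup_i F i.
  apply/seteqP; split => x /=; rewrite in_itv/=.
    move=> /andP[x0 x1]; have x10 : 0 < 1 - x by rewrite subr_gt0.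
    have [n _ /(_ _ (leqnn _)) nx] := near_infty_natSinv_lt (PosNum x10).
    exists n => //; rewrite /F /= in_itv/= x0/=.
    have : n.+2%:R^-1 <= n.+1%:R^-1 :> R by rewrite lef_pV2 ?posrE// ler_nat.
    by move=> /le_lt_trans /(_ nx) /=; rewrite ltrBrDl -ltrBrDr => /ltW.
  move=> [i _]; rewrite /F /= in_itv/= => /andP[-> /le_lt_trans]; apply.
  by rewrite gtrBl invr_gt0.
have cv : (\int[lebesgue_measure]_(x in F i) ((1 - x) `^ (b - 1))%:E @[i --> \oo] -->
    \int[lebesgue_measure]_(x in \bigcup_i F i) ((1 - x) `^ (b - 1))%:E)%E.
  apply: ge0_nondecreasing_set_cvg_integral => //.
  - move=> m' n mn; apply/subsetPset; apply: subset_itvl; rewrite bnd_simp.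
    by rewrite lerB// lef_pV2 ?posrE// ler_nat.
  - by move=> i; exact: measurable_itv.
  - by move=> i; exact: mE.
  - by move=> i x _; rewrite lee_fin powR_ge0.
apply: (@le_lt_trans _ _ (1 / b)%:E); last exact: ltry.
by apply: cvge_to_le cv _; exact: nearW.
Qed.

Lemma finite_poly_roots (F : fieldType) (p : {poly F}) :
  p != 0 -> finite_set [set x | root p x].
Proof.
have [n] := ubnP (size p); elim: n p => // n IHn p pn p0.
have [[a /factor_theorem[q pE]]|noroot] := pselect (exists a, root p a); last first.
  by apply: sub_finite_set (finite_set0 _) => x /= px; apply: noroot; exists x.
have q0 : q != 0 by apply: contraNneq p0 => q0; rewrite pE q0 mul0r.
have fq : finite_set [set x | root q x].
  apply: IHn => //; rewrite -ltnS (leq_trans _ pn)// pE size_Mmonic ?monicXsubC//.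
  by rewrite size_XsubC addn2.
apply: sub_finite_set (_ : finite_set ([set x | root q x] `|` [set a])); last first.
  by rewrite finite_setU; split => //; exact: finite_set1.
by move=> x /=; rewrite pE rootM root_XsubC => /orP[|/eqP]; [left|right].
Qed.

(** * Polynomial moments of kernels on the unit interval *)

Section Kernels.
Variables (R : realType) (b : R).
Hypothesis b_gt0 : 0 < b.
Let mu := @lebesgue_measure R.

(** A common class for the kernels of [L], [J0] and [J1]. The bound also holds at the endpoints; at
    1 it forces [k 1 = 0] unless [b = 1], because 0 to a nonzero power is 0. *)
Definition kernel01 (k : R -> R) :=
  (forall x, 0 < x < 1 -> {for x, continuous k}) /\
  exists C, forall x, 0 <= x <= 1 -> `|k x| <= C * (1 - x) `^ (b - 1).

Lemma horner_bounded (p : {poly R}) :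
  exists2 C, 0 <= C & forall x, 0 <= x <= 1 -> `|p.[x]| <= C.
Proof.
elim/poly_ind: p => [|p c [C C0 pC]].
  by exists 0 => // x _; rewrite horner0 normr0.
exists (C + `|c|); first exact: addr_ge0.
move=> x /andP[x0 x1]; rewrite hornerMXaddC (le_trans (ler_normD _ _))// lerD2r.
rewrite normrM -[C]mulr1 ler_pM// ?pC ?x0//.
by rewrite ger0_norm.
Qed.

Lemma kernel01_horner k (p : {poly R}) : kernel01 k -> kernel01 (fun x => p.[x] * k x).
Proof.
move=> [ck [C kC]]; have [D D0 pD] := horner_bounded p; split.
  move=> x x01; apply: continuousM (ck _ x01).
  exact: continuous_horner.
by exists (D * C) => x x01; rewrite normrM -mulrA ler_pM// ?kC// pD.
Qed.

Lemma kernel01_integrable k : kernel01 k -> mu.-integrable `[0, 1] (EFin \o k).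
Proof.
move=> [ck [C kC]].
have mk : measurable_fun (`[0, 1] : set R) k.
  apply: (@measurable_fun_itv_cc _ _ _ false true).
  apply: open_continuous_measurable_fun; first exact: interval_open.
  by move=> x; rewrite inE/= in_itv/= => /ck.
have ib := integrable_powR_itv b_gt0.
apply: (le_integrable _ _ _ (integrableZl _ C ib)).
- exact: measurable_itv.
- by apply/measurable_EFinP; exact: mk.
- move=> x /=; rewrite in_itv/= => /kC kCx.
  by rewrite lee_fin (le_trans kCx)// ler_norm.
- exact: measurable_itv.
Qed.

Definition moment (k : R -> R) (p : {poly R}) := int01 (fun x => p.[x] * k x).

(** Bundles the integral as a linear form, to instantiate the algebraic section. *)
Lemma moment_linear k : kernel01 k ->
  exists L : {scalar {poly R}}, forall p, L p = moment k p.
Proof.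
move=> kk.
have lin : linear_for *%R (moment k).
  move=> a u v; rewrite /moment /int01.
  rewrite -RintegralZl//; last exact/kernel01_integrable/kernel01_horner.
  rewrite -RintegralD//; last 2 first.
  - rewrite (_ : (fun x => a * (u.[x] * k x)) = (fun x => (a *: u).[x] * k x)).
      exact/kernel01_integrable/kernel01_horner.
    by apply/funext => x; rewrite hornerZ mulrA.
  - exact/kernel01_integrable/kernel01_horner.
  by apply: eq_Rintegral => x _; rewrite hornerD hornerZ; ring.
pose M := GRing.isLinear.Build _ _ _ _ (moment k) lin.
by exists (HB.pack (moment k) M : {scalar {poly R}}).
Qed.

Lemma moment_ge0 k p : (forall x, 0 <= x <= 1 -> 0 <= p.[x] * k x) -> 0 <= moment k p.
Proof.
by move=> h; apply: Rintegral_ge0 => x /=; rewrite in_itv/= => /h.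
Qed.

(** If the integral were 0, the integrand would vanish almost everywhere; it is nonzero off the
    roots of [p] and the endpoints, so [[0, 1]] would be a null set. *)
Lemma moment_gt0 k p : kernel01 k -> p != 0 ->
  (forall x, 0 <= x <= 1 -> 0 <= p.[x] * k x) ->
  (forall x, 0 < x < 1 -> k x != 0) -> 0 < moment k p.
Proof.
move=> kk p0 pk0 k0.
rewrite lt_neqAle moment_ge0// andbT eq_sym; apply/eqP => m0.
have ik := kernel01_integrable (kernel01_horner p kk).
have mk := measurable_int _ ik.
have i0 : (\int[mu]_(x in `[0%R, 1%R]) `|(p.[x] * k x)%:E| = 0)%E.
  have -> : 0%E = (moment k p)%:E by rewrite m0.
  rewrite /moment /int01 /Rintegral fineK; last first.
    exact: integrable_fin_num.
  apply: eq_integral => x; rewrite inE/= in_itv/= => /pk0 px.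
  by rewrite ger0_norm.
have [N [mN N0 subN]] := (ae_eq_integral_abs mu (measurable_itv _) mk).1 i0.
pose Z : set R := [set x | root p x] `|` [set 0; 1].
have fZ : finite_set Z.
  by rewrite !finite_setU; split; [exact: finite_poly_roots|split; exact: finite_set1].
have Z0 : mu Z = 0%E by apply: countable_lebesgue_measure0; exact: finite_set_countable.
have sub : (`[0, 1] : set R) `<=` N `|` Z.
  move=> x /=; rewrite in_itv/= => /andP[x0 x1].
  have [|Zx] := pselect (Z x); first by right.
  left; apply: subN => /= H.
  have px : p.[x] != 0 by apply/eqP => px; apply: Zx; left; exact/rootP.
  have x01 : 0 < x < 1.
    rewrite !lt_neqAle x0 x1 !andbT; apply/andP.
    by split; apply/eqP => xE; apply: Zx; right; [left|right].
  have := H _; rewrite in_itv/= x0 x1 => /(_ isT) [] /eqP.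
  by rewrite mulf_eq0 (negbTE px) (negbTE (k0 _ x01)).
have mZ : measurable Z.
  exact: countable_measurable (finite_set_countable fZ).
have : (mu (`[0%R, 1%R] : set R) <= 0)%E.
  apply: (le_trans (le_measure mu _ _ sub)); rewrite ?inE.
  - exact: measurable_itv.
  - exact: measurableU.
  - apply: (le_trans (measureU2 _ mN mZ)).
    by rewrite [X in (X + _)%E]N0 [X in (_ + X)%E]Z0 adde0.
by rewrite /mu lebesgue_measure_itv/= lte_fin ltr01 oppr0 adde0 lee_fin ler10.
Qed.

End Kernels.

Section IntegrableReal.
Variables (R : realType) (a b : R).
Local Notation mu := (@lebesgue_measure R).

Lemma integrable_addr (f g : R -> R) :
  mu.-integrable `[a, b] (EFin \o f) -> mu.-integrable `[a, b] (EFin \o g) ->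
  mu.-integrable `[a, b] (EFin \o (fun x => f x + g x)).
Proof.
move=> fi gi; have mab : measurable (`[a, b] : set (measurableTypeR R)) by exact: measurable_itv.
by have := integrableD mab fi gi; apply: eq_integrable => // x _; rewrite /= EFinD.
Qed.

Lemma integrable_subr (f g : R -> R) :
  mu.-integrable `[a, b] (EFin \o f) -> mu.-integrable `[a, b] (EFin \o g) ->
  mu.-integrable `[a, b] (EFin \o (fun x => f x - g x)).
Proof.
move=> fi gi; have mab : measurable (`[a, b] : set (measurableTypeR R)) by exact: measurable_itv.
by have := integrableB mab fi gi; apply: eq_integrable => // x _; rewrite /= EFinB.
Qed.

End IntegrableReal.

(** * The weight and its integration by parts *)

Section Weight.
Variables (R : realType) (alpha beta t : R).
Hypotheses (alpha_gt0 : 0 < alpha) (beta_gt0 : 0 < beta) (t_ge0 : 0 <= t).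
Local Notation w := (pj_weight alpha beta t).

Lemma weight0 : w 0 = 0.
Proof. by rewrite /pj_weight powR0 ?gt_eqF// mulr0 mul0r. Qed.

Lemma weight1 : w 1 = 0.
Proof. by rewrite /pj_weight subrr [0 `^ beta]powR0 ?gt_eqF// mulr0. Qed.

Lemma weight_gt0 x : 0 < x < 1 -> 0 < w x.
Proof.
move=> /andP[x0 x1].
by rewrite /pj_weight !mulr_gt0 ?expR_gt0 ?powR_gt0// subr_gt0.
Qed.

Lemma weight_ge0 x : 0 <= w x.
Proof. by rewrite /pj_weight !mulr_ge0 ?expR_ge0 ?powR_ge0. Qed.

Lemma powR_le1 (a x : R) : 0 <= a -> 0 <= x <= 1 -> x `^ a <= 1.
Proof.
move=> a0 /andP[x0 x1]; have one_a : 1 `^ a = 1 :> R by rewrite powR1.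
rewrite -one_a.
by apply: ge0_ler_powR; rewrite ?nnegrE.
Qed.

Lemma weight_le x : 0 <= x <= 1 -> w x <= (1 - x) `^ beta.
Proof.
move=> x01; rewrite /pj_weight -[leRHS]mul1r ler_wpM2r ?powR_ge0//.
rewrite mulr_ile1 ?expR_ge0 ?powR_ge0 ?(powR_le1 (ltW alpha_gt0))//.
by case/andP: x01 => x0 _; rewrite expR_le1 mulNr oppr_le0 divr_ge0.
Qed.

Lemma weight_t_le x : 0 <= x <= 1 -> t / x * w x <= (1 - x) `^ beta.
Proof.
move=> x01; have /andP[x0 x1] := x01.
rewrite /pj_weight !mulrA -[leRHS]mul1r ler_wpM2r ?powR_ge0//.
rewrite mulr_ile1 ?powR_ge0 ?(powR_le1 (ltW alpha_gt0))//.
  by rewrite mulr_ge0 ?expR_ge0 ?divr_ge0.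
(* With [u = t / x] this is [u <= 1 + u <= exp u]: the exponential absorbs the pole at 0. *)
rewrite mulNr expRN ler_pdivrMr ?expR_gt0// mul1r (le_trans _ (expR_ge1Dx _))//.
by rewrite lerDr.
Qed.

Lemma powR_onem x : x <= 1 -> (1 - x) `^ beta = (1 - x) * (1 - x) `^ (beta - 1).
Proof.
rewrite le_eqVlt => /predU1P[->|x1]; first by rewrite subrr mul0r powR0 ?gt_eqF.
have x0 : 0 < 1 - x by rewrite subr_gt0.
rewrite -{2}[1 - x]powRr1 ?ltW// -powRD; last by apply/implyP => _; rewrite gt_eqF.
by congr (_ `^ _); ring.
Qed.

Lemma is_derive_weight (x : R) : 0 < x < 1 ->
  is_derive x 1 w (w x * (t / x ^+ 2 + alpha / x - beta / (1 - x))).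
Proof.
move=> /andP[x0 x1].
have x10 : 0 < 1 - x by rewrite subr_gt0.
have d1 : is_derive x 1 (fun y : R => - t / y) (t / x ^+ 2).
  have x_neq0 : x != 0 by rewrite gt_eqF.
  have d := is_deriveZ (- t) (@is_deriveV _ id x 1 1 x_neq0 (is_derive_id x 1)).
  apply: is_derive_eq d _.
  by rewrite /GRing.scale /=; field.
have d2 : is_derive x 1 (fun y : R => expR (- t / y)) (expR (- t / x) * (t / x ^+ 2)).
  exact: is_derive1_comp.
have d3 : is_derive x 1 (fun y : R => y `^ alpha) (alpha * x `^ (alpha - 1)).
  exact: is_derive1_powR.
have d4 := is_derive_powR_onem beta x1.
have d5 : is_derive x 1 (fun y : R => expR (- t / y) * y `^ alpha) _ :=
  is_deriveM d2 d3.
have d := is_deriveM d5 d4.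
apply: is_derive_eq d _.
rewrite /GRing.scale /= /pj_weight (powR_onem (ltW x1)).
have -> : x `^ alpha = x * x `^ (alpha - 1).
  rewrite -{2}[x]powRr1 ?ltW// -powRD; last by apply/implyP => _; rewrite gt_eqF.
  by congr (_ `^ _); ring.
field.
by rewrite !gt_eqF.
Qed.

Lemma kernel01_of_weight (c : R -> R) (C : R) :
  (forall x, 0 < x < 1 -> {for x, continuous c}) ->
  (forall x, 0 <= x <= 1 -> 0 <= c x * w x <= C * (1 - x) `^ (beta - 1)) ->
  kernel01 beta (fun x => c x * w x).
Proof.
move=> cc cw; split.
  move=> x x01; apply: continuousM; first exact: cc.
  exact: is_derive_continuous (is_derive_weight x01).
by exists C => x /cw /andP[c0 c1]; rewrite ger0_norm.
Qed.

Lemma powR_onem_le x : 0 <= x <= 1 -> (1 - x) `^ beta <= (1 - x) `^ (beta - 1).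
Proof.
move=> /andP[x0 x1]; rewrite powR_onem// -[leRHS]mul1r ler_wpM2r ?powR_ge0//.
by rewrite gerBl.
Qed.

Lemma kernel01_weight : kernel01 beta w.
Proof.
rewrite (_ : pj_weight alpha beta t = fun x => 1 * w x); last first.
  by apply/funext => x; rewrite mul1r.
apply: (@kernel01_of_weight (fun=> 1) 1) => x x01; first exact: cst_continuous.
by rewrite !mul1r weight_ge0 (le_trans (weight_le x01))// powR_onem_le.
Qed.

Lemma kernel01_weight0 : kernel01 beta (fun x => t / x * w x).
Proof.
apply: (@kernel01_of_weight (fun x => t / x) 1) => x /[dup] x01 /andP[x0 x1].
  apply: continuousM; first exact: cst_continuous.
  by apply: inv_continuous; rewrite gt_eqF.
rewrite mul1r mulr_ge0 ?weight_ge0 ?divr_ge0//=.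
by rewrite (le_trans (weight_t_le x01))// powR_onem_le.
Qed.

Lemma kernel01_weight1 : kernel01 beta (fun x => beta / (1 - x) * w x).
Proof.
apply: (@kernel01_of_weight (fun x => beta / (1 - x)) beta) => x /[dup] x01 /andP[x0 x1].
  apply: continuousM; first exact: cst_continuous.
  apply: continuousV; first by rewrite subr_eq0 gt_eqF.
  by apply: continuousB; [exact: cst_continuous|exact: cvg_id].
have x10 : 0 <= 1 - x by rewrite subr_ge0.
rewrite mulr_ge0 ?weight_ge0 ?divr_ge0 ?(ltW beta_gt0)//=.
rewrite -mulrA ler_pM2l//.
(* At 1 the division convention is harmless since [w 1 = 0]; elsewhere one factor of
   [(1 - x) ^ beta] cancels the denominator. *)
have [->|x_neq1] := eqVneq x 1; first by rewrite weight1 mulr0 powR_ge0.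
have x1' : 0 < 1 - x by rewrite subr_gt0 lt_neqAle x_neq1.
by rewrite mulrC ler_pdivrMr// mulrC -powR_onem// weight_le.
Qed.

Lemma onem_at_left : 1 - x @[x --> (1 : R)^'-] --> (0 : R)^'+.
Proof.
move=> A [e /= e0 eA]; exists e => //= y; rewrite /ball/= => ye y1.
apply: eA; last by rewrite subr_gt0.
by rewrite /ball/= sub0r normrN.
Qed.

(** The function [x p w] tends to 0 at both ends, so its derivative has integral 0. *)
Lemma moment_parts (p : {poly R}) :
  moment (fun x => t / x * w x) p + alpha * moment w p + moment w ('X * p)^`() =
  moment (fun x => beta / (1 - x) * w x) p - beta * moment w p.
Proof.
pose F x := ('X * p).[x] * w x.
(* The coefficient [alpha + beta] comes from [- beta * x / (1 - x) = beta - beta / (1 - x)]. *)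
pose q := ('X * p)^`() + (alpha + beta) *: p.
pose k0 x := t / x * w x; pose k1 x := beta / (1 - x) * w x.
pose f x := q.[x] * w x + p.[x] * k0 x - p.[x] * k1 x.
have iq := kernel01_integrable beta_gt0 (kernel01_horner q kernel01_weight).
have i0 := kernel01_integrable beta_gt0 (kernel01_horner p kernel01_weight0).
have i1 := kernel01_integrable beta_gt0 (kernel01_horner p kernel01_weight1).
have iq0 : lebesgue_measure.-integrable `[0, 1] (EFin \o (fun x => q.[x] * w x + p.[x] * k0 x)).
  exact: integrable_addr.
have intf : int01 f = 0.
  rewrite -[RHS](subrr 0).
  apply: (@Rintegral_oo_is_derive _ f F) => //.
  - exact: integrable_subr.
  - move=> x x01.
    have cw := is_derive_continuous (is_derive_weight x01).
    have [c0 _] := kernel01_horner p kernel01_weight0.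
    have [c1 _] := kernel01_horner p kernel01_weight1.
    have [cq _] := kernel01_horner q kernel01_weight.
    apply: continuousB; last exact: c1.
    by apply: continuousD; [exact: cq|exact: c0].
  - move=> x x01.
    have d := is_deriveM (is_derive_poly ('X * p) x) (is_derive_weight x01).
    apply: is_derive_eq d _.
    rewrite /GRing.scale /= /f /q /k0 /k1 hornerD hornerZ hornerM hornerX.
    have /andP[x0 x1] := x01; field.
    by rewrite !gt_eqF// subr_gt0.
  (* At 0 the factor [x] gives the limit, as [w <= 1]; at 1, below, the polynomial is merely bounded
     and [w <= (1 - x) ^ beta] gives it. *)
  - apply/norm_cvg0P.
    apply: (@squeeze_cvgr _ _ _ _ (cst 0) (fun x => `|('X * p).[x]|)).
    + near=> x.
      have x01 : 0 <= x <= 1.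
        by apply/andP; split; [near: x; exact: nbhs_right_ge|near: x; exact: nbhs_right_le].
      rewrite normr_ge0/= /F normrM -[leRHS]mulr1 ler_wpM2l//.
      rewrite ger0_norm ?weight_ge0// (le_trans (weight_le x01))//.
      have /andP[x0 x1] := x01.
      by apply: powR_le1; [exact: ltW|rewrite subr_ge0 x1 gerBl x0].
    + exact: cvg_cst.
    + apply/norm_cvg0P; apply: cvg_at_right_filter.
      have e : ('X * p).[0] = 0 by rewrite hornerM hornerX mul0r.
      by rewrite -[X in _ --> X]e; exact: continuous_horner.
  - have [D D0 pD] := horner_bounded ('X * p).
    apply/norm_cvg0P.
    apply: (@squeeze_cvgr _ _ _ _ (cst 0) (fun x => D * (1 - x) `^ beta)).
    + near=> x.
      have x01 : 0 <= x <= 1.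
        by apply/andP; split; [near: x; exact: nbhs_left_ge|near: x; exact: nbhs_left_le].
      rewrite normr_ge0/= /F normrM ler_pM ?pD//.
      by rewrite ger0_norm ?weight_ge0// weight_le.
    + exact: cvg_cst.
    + rewrite -(mulr0 D); apply: cvgM; first exact: cvg_cst.
      exact: cvg_comp onem_at_left (powR_cvg0 beta_gt0).
have : int01 f = moment w q + moment k0 p - moment k1 p.
  by rewrite /int01 RintegralB// RintegralD.
rewrite intf.
have [L LE] := moment_linear beta_gt0 kernel01_weight.
rewrite -!LE /q linearD functionalZ /k0 /k1.
by lra.
Unshelve. all: by end_near. Qed.

End Weight.

(** * Instantiation at the Pollaczek-Jacobi weight *)

Theorem lemma6p3 (R : realType) (alpha beta t : R)
  (alpha_gt0 : 0 < alpha) (beta_gt0 : 0 < beta) (t_ge0 : 0 <= t)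
  (P : nat -> {poly R}) (h a b : nat -> R)
  (orthP : monic_orthogonal (pj_weight alpha beta t) P h)
  (recP : three_term_recurrence P a b)
  (n : nat) (n_ge1 : (1 <= n)%N) :
  r_coef alpha beta t P h n =
    (- p1 P n ^+ 2 - (2 * n%:R + alpha - t) * p1 P n + n%:R * t
     - (1 - (2 * n%:R + alpha + beta) ^+ 2) * b n)
    / (2 * n%:R + alpha + beta)
  /\ b n = X_coef alpha beta t P n / Y_coef alpha beta t P n.
Proof.
have [P_monic orth] := orthP.
have kw : kernel01 beta (pj_weight alpha beta t) by exact: kernel01_weight.
have k0 : kernel01 beta (fun x => t / x * pj_weight alpha beta t x).
  exact: kernel01_weight0.
have k1 : kernel01 beta (fun x => beta / (1 - x) * pj_weight alpha beta t x).
  exact: kernel01_weight1.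
have [L LE] := moment_linear beta_gt0 kw.
have [J0 J0E] := moment_linear beta_gt0 k0.
have [J1 J1E] := moment_linear beta_gt0 k1.
have orthL i j : L (P i * P j) = if i == j then h j else 0.
  by rewrite LE -orth; apply: eq_Rintegral => x _; rewrite hornerM.
have P_neq0 i : P i != 0 by rewrite monic_neq0//; case: (P_monic i).
have wpos x : 0 < x < 1 -> pj_weight alpha beta t x != 0.
  by move=> x01; rewrite gt_eqF// weight_gt0.
have h_gt0 i : 0 < h i.
  have <- : L (P i * P i) = h i by rewrite orthL eqxx.
  rewrite LE; apply: (moment_gt0 beta_gt0) => //; first by rewrite mulf_neq0.
  by move=> x _; rewrite hornerM -expr2 mulr_ge0 ?sqr_ge0 ?weight_ge0.
have J0X f : J0 ('X * f) = t * L f.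
  rewrite J0E LE /moment /int01 -RintegralZl; last 2 first.
  - exact: measurable_itv.
  - exact/(kernel01_integrable beta_gt0)/kernel01_horner.
  apply: eq_Rintegral => x _; rewrite hornerM hornerX.
  (* At 0, where [t / x] is conventional, both sides vanish with [w]. *)
  have [->|x0] := eqVneq x 0; first by rewrite weight0//; ring.
  by field.
have J1X f : J1 ('X * f) = J1 f - beta * L f.
  (* Rearranged as [J1 (f - x f) = beta * L f], where [1 - x] cancels the pole; at 1 both integrands
     vanish with [w]. *)
  apply/eqP; rewrite eq_sym subr_eq addrC -subr_eq -linearB eq_sym; apply/eqP.
  rewrite J1E LE /moment /int01 -RintegralZl; last 2 first.
  - exact: measurable_itv.
  - exact/(kernel01_integrable beta_gt0)/kernel01_horner.
  apply: eq_Rintegral => x _; rewrite hornerD hornerN hornerM hornerX.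
  have [->|x1] := eqVneq x 1; first by rewrite weight1//; ring.
  by field; rewrite subr_eq0 eq_sym.
have parts f : J0 f + alpha * L f + L ('X * f)^`() = J1 f - beta * L f.
  by rewrite J0E J1E !LE; exact: moment_parts.
have J0_ge0 i : 0 <= J0 (P i * P i).
  rewrite J0E; apply: moment_ge0 => x /andP[x0 x1].
  by rewrite hornerM -expr2 mulr_ge0 ?sqr_ge0// mulr_ge0 ?weight_ge0// divr_ge0.
(* This positivity is the source of [0 < a i]. *)
have LX_gt0 i : 0 < L ('X * P i * P i).
  rewrite LE; apply: (moment_gt0 beta_gt0) => //.
    by rewrite !mulf_neq0 ?polyX_eq0.
  move=> x /andP[x0 _]; rewrite !hornerM hornerX -mulrA -expr2.
  by rewrite mulr_ge0 ?weight_ge0// mulr_ge0 ?sqr_ge0.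
case: n n_ge1 => // n _; split; last first.
  exact: (b_X_Y (J0 := J0) (J1 := J1) P_monic orthL).
rewrite -(r_coef_b_formula P_monic orthL recP h_gt0 J0X J1X parts alpha_gt0 beta_gt0).
rewrite /r_coef J1E /= mulrAC; congr (_ / _).
(* The kernel of [J1] contains [beta], which [r_coef] keeps outside the integral; scaling the
   polynomial by [beta^-1] compensates. *)
have fE : (fun y => (P n).[y] * (P n.+1).[y] * pj_weight alpha beta t y / (1 - y))
    = (fun y => (beta^-1 *: (P n * P n.+1)).[y]
                * (beta / (1 - y) * pj_weight alpha beta t y)).
  apply/funext => y; rewrite hornerZ hornerM.
  by rewrite [_ / (1 - y)]mulrC; set z := (1 - y)^-1; field; rewrite gt_eqF.
by rewrite fE -[int01 _]J1E functionalZ mulrA divff ?mul1r ?gt_eqF// J1E.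
Qed.
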